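(* Let $\mathcal{H}_1,\mathcal{H}_2,\ldots,\mathcal{H}_n$ be complex Hilbert spaces, and let $\mathbf{A}=[A_{ij}]_{i,j=1}^n$ be an $n\times n$ operator matrix with $A_{ij}\in\mathcal{B}(\mathcal{H}_j,\mathcal{H}_i)$, regarded as a bounded operator on $\oplus_{i=1}^n\mathcal{H}_i$. Then $$w(\mathbf{A})\le w\left([a_{ij}]_{i,j=1}^n\right),$$ where $[a_{ij}]$ is the real $n\times n$ matrix (acting on $\mathbb{C}^n$) with entries $$a_{ij}=\begin{cases} w(A_{ii}) & \text{if } i=j,\\ \sqrt{\left(\|A_{ij}\|+\|A_{ji}\|\right)^2-\left(\|A_{ij}\|\,\|A_{ji}\|-w(A_{ji}A_{ij})\right)} & \text{if } i<j,\\ 0 & \text{if } i>j.\end{cases}$$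
   Context: $\mathcal{B}(\mathcal{H},\mathcal{K})$ is the space of bounded linear operators from $\mathcal{H}$ to $\mathcal{K}$, and $\mathcal{B}(\mathcal{H})=\mathcal{B}(\mathcal{H},\mathcal{H})$. For $A\in\mathcal{B}(\mathcal{H})$, the numerical radius is $w(A)=\sup\{|\langle Ax,x\rangle|: x\in\mathcal{H},\ \|x\|=1\}$; $\|\cdot\|$ is the operator norm. The operator matrix $\mathbf{A}=[A_{ij}]$ acts on the Hilbert space direct sum $\oplus_{i=1}^n\mathcal{H}_i$ by $(\mathbf{A}x)_i=\sum_{j=1}^n A_{ij}x_j$. *)

(* Defs.v *)
From HB Require Import structures.
From mathcomp Require Import all_boot all_order all_algebra.
From mathcomp Require Import complex.
From mathcomp Require Import all_classical all_reals all_analysis.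

Set Implicit Arguments.
Unset Strict Implicit.
Unset Printing Implicit Defensive.

Import Order.TTheory GRing.Theory Num.Theory.
Import numFieldNormedType.Exports.

Local Open Scope classical_set_scope.
Local Open Scope complex_scope.
Local Open Scope ring_scope.

HB.mixin Record CompleteNormedModule_isHilbert (R : realType) H
    of CompleteNormedModule R[i] H := {
  inner : {dot H for @Num.conj R[i]} ;
  sqr_norm_inner : forall x : H, `|x| ^+ 2 = inner x x }.

(* Complex Hilbert spaces; as for every {dot _ for _}, the inner product is
   linear in its first argument and conjugate-linear in the second one. *)
#[short(type="hilbertType")]
HB.structure Definition Hilbert (R : realType) :=
  {H of CompleteNormedModule R[i] H & CompleteNormedModule_isHilbert R H}.

HB.mixin Record isBounded (R : realType) (H K : normedModType R[i])
    (f : H -> K) := {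
  bounded_subproof : exists M : R, forall x, `|f x| <= M%:C * `|x| }.

#[short(type="boundedOp")]
HB.structure Definition BoundedOp (R : realType) (H K : normedModType R[i]) :=
  {f of isBounded R H K f & @GRing.Linear R[i] H K *:%R f}.

Notation "''B' ( H , K )" := (@BoundedOp.type _ H K)
  (at level 8, format "''B' ( H ,  K )") : type_scope.

Section composition.
Context (R : realType) (H K L : normedModType R[i]) (g : 'B(K, L)) (f : 'B(H, K)).

Lemma comp_bounded : exists M : R, forall x, `|(g \o f) x| <= M%:C * `|x|.
Proof.
have [[M Mg] [N Nf]] := (@bounded_subproof R K L g, @bounded_subproof R H K f).
exists (`|M| * N) => x /=.
have M_le : M%:C <= `|M|%:C :> R[i] by rewrite lecR ler_norm.
apply: le_trans (Mg _) _; apply: le_trans (ler_wpM2r (normr_ge0 _) M_le) _.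
by rewrite rmorphM /= -mulrA ler_wpM2l ?lecR.
Qed.

HB.instance Definition _ := isBounded.Build R H L (g \o f) comp_bounded.
End composition.

(* The norm of a normed module over R[i] takes its values in the nonnegative
   reals of R[i]; [Re] brings them back to R. On the trivial space the set
   below is empty and its sup is 0. *)
Definition numradius (R : realType) (H : hilbertType R) (A : 'B(H, H)) : R :=
  sup [set complex.Re `|inner (A x) x| | x in [set x : H | `|x| = 1]].

Definition opnorm (R : realType) (H K : normedModType R[i]) (A : 'B(H, K)) : R :=
  sup [set complex.Re `|A x| | x in [set x : H | `|x| <= 1]].

Definition hsum (R : realType) n (H : 'I_n -> hilbertType R) : Type :=
  forall i, H i.

Section complex_hilbert.
Context (R : realType).

HB.instance Definition _ := NormedModule.copy R[i] R[i]^o.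

Fact complex_complete (F : set_system R[i]) : ProperFilter F -> cauchy F -> cvg F.
Proof.
move=> FF /cauchy_ballP F_cauchy.
have part_cvg (p : R[i] -> R) : (forall x y, p (x - y) = p x - p y) ->
    (forall x, `|p x|%:C <= `|x|) -> exists l : R, p @ F --> l.
  move=> pB p_le; apply/cvg_ex; apply: cauchy_cvg; apply/cauchy_ballP => e e0 /=.
  have eC0 : 0 < e%:C by rewrite ltcR.
  have := F_cauchy _ eC0; rewrite !near_simpl => -[[/= P Q] [/= FP FQ] PQ].
  exists (P, Q) => // -[x y] /= xy.
  have := PQ (x, y) xy; rewrite -!ball_normE /= -pB -ltcR.
  exact: le_lt_trans.
have Im_le (x : R[i]) : `|complex.Im x|%:C <= `|x|.
  rewrite normc_def lecR -[leLHS]sqrtr_sqr ler_wsqrtr //.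
  by rewrite lerDr sqr_ge0.
have [a a_cvg] := part_cvg _ (raddfB (@complex.Re R)) (@normc_ge_Re R).
have [b b_cvg] := part_cvg _ (raddfB (@complex.Im R)) Im_le.
apply/cvg_ex; exists (a +i* b); apply/cvgrPdist_lt => e e0.
have eE : e = (complex.Re e)%:C by rewrite RRe_real // gtr0_real.
have e2 : 0 < complex.Re e / 2 by rewrite divr_gt0 // -ltcR -eE.
move/cvgrPdist_lt : a_cvg => /(_ _ e2) a_near.
move/cvgrPdist_lt : b_cvg => /(_ _ e2) b_near.
apply: filterS2 a_near b_near => -[c d] /= ac bd.
rewrite eE normc_def ltcR /=; apply: le_lt_trans (_ : `|a - c| + `|b - d| < _).
  rewrite -[leRHS]ger0_norm ?addr_ge0 // -sqrtr_sqr ler_wsqrtr //.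
  by rewrite -(real_normK (num_real (a - c))) -(real_normK (num_real (b - d)))
    sqrrD addrAC lerDl mulrn_wge0 // mulr_ge0.
by rewrite [ltRHS]splitr ltrD.
Qed.

HB.instance Definition _ := Uniform_isComplete.Build R[i] complex_complete.

Definition complex_inner (x y : R[i]) : R[i] := x * y^*%R.

Fact complex_inner_bilinear :
  bilinear_for *%R (@Num.conj R[i] \; *%R) complex_inner.
Proof.
split=> z c x y /=; rewrite /complex_inner; first by rewrite mulrDl mulrA.
by rewrite rmorphD rmorphM mulrDr mulrCA.
Qed.

HB.instance Definition _ := bilinear_isBilinear.Build R[i] R[i] R[i] R[i]
  *%R (@Num.conj R[i] \; *%R) complex_inner complex_inner_bilinear.

Fact complex_inner_hermitian x y :
  complex_inner x y = (-1) ^+ false * (complex_inner y x)^*%R.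
Proof. by rewrite expr0 mul1r /complex_inner rmorphM /= conjCK mulrC. Qed.

HB.instance Definition _ := isHermitianSesquilinear.Build R[i] R[i] false
  (@Num.conj R[i]) complex_inner complex_inner_hermitian.

Fact complex_inner_gt0 x : x != 0 -> 0 < complex_inner x x.
Proof. by move=> x0; rewrite /complex_inner -normCK exprn_gt0 // normr_gt0. Qed.

HB.instance Definition _ :=
  isDotProduct.Build R[i] R[i] complex_inner complex_inner_gt0.

HB.instance Definition _ := CompleteNormedModule_isHilbert.Build R R[i]
  (@normCK R[i] : forall x, _ = complex_inner x x).
End complex_hilbert.

Section hsum_lmod.
Context (R : realType) (n : nat) (H : 'I_n -> hilbertType R).
Implicit Types x y z : hsum H.

HB.instance Definition _ := gen_eqMixin (hsum H).
HB.instance Definition _ := gen_choiceMixin (hsum H).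

Let add x y : hsum H := fun i => x i + y i.
Let opp x : hsum H := fun i => - x i.
Let zero : hsum H := fun=> 0.
Let scale (a : R[i]) x : hsum H := fun i => a *: x i.

Fact hsum_addA : associative add.
Proof. by move=> x y z; apply: functional_extensionality_dep => i; apply: addrA. Qed.
Fact hsum_addC : commutative add.
Proof. by move=> x y; apply: functional_extensionality_dep => i; apply: addrC. Qed.
Fact hsum_add0 : left_id zero add.
Proof. by move=> x; apply: functional_extensionality_dep => i; apply: add0r. Qed.
Fact hsum_addN : left_inverse zero opp add.
Proof. by move=> x; apply: functional_extensionality_dep => i; apply: addNr. Qed.

HB.instance Definition _ :=
  GRing.isZmodule.Build (hsum H) hsum_addA hsum_addC hsum_add0 hsum_addN.

Fact hsum_scaleA a b x : scale a (scale b x) = scale (a * b) x.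
Proof. by apply: functional_extensionality_dep => i; apply: scalerA. Qed.
Fact hsum_scale1 : left_id 1 scale.
Proof. by move=> x; apply: functional_extensionality_dep => i; apply: scale1r. Qed.
Fact hsum_scaleDr : right_distributive scale +%R.
Proof. by move=> a x y; apply: functional_extensionality_dep => i; apply: scalerDr. Qed.
Fact hsum_scaleDl x : {morph scale^~ x : a b / a + b}.
Proof. by move=> a b; apply: functional_extensionality_dep => i; apply: scalerDl. Qed.

HB.instance Definition _ := GRing.Zmodule_isLmodule.Build R[i] (hsum H)
  hsum_scaleA hsum_scale1 hsum_scaleDr hsum_scaleDl.
End hsum_lmod.

Section hsum_hilbert.
Context (R : realType) (n : nat) (H : 'I_n -> hilbertType R).
Implicit Types x y z : hsum H.

Definition hsum_norm x : R[i] := sqrtC (\sum_i `|x i| ^+ 2).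
Definition hsum_inner x y : R[i] := \sum_i inner (x i) (y i).

Fact hsum_sqr_ge0 x : 0 <= \sum_i `|x i| ^+ 2.
Proof. by apply: sumr_ge0 => i _; exact: exprn_ge0. Qed.

Fact hsum_coord_le x i : `|x i| <= hsum_norm x.
Proof.
rewrite -[`|x i|]sqrCK // ler_sqrtC ?nnegrE ?exprn_ge0 ?hsum_sqr_ge0 //.
by rewrite (bigD1 i) //= lerDl; apply: sumr_ge0 => j _; exact: exprn_ge0.
Qed.

Fact hsum_norm_le x : hsum_norm x <= \sum_i `|x i|.
Proof.
have s0 : 0 <= \sum_i `|x i| by apply: sumr_ge0.
rewrite -[leRHS]sqrCK // ler_sqrtC ?nnegrE ?exprn_ge0 ?hsum_sqr_ge0 //.
rewrite [leRHS]expr2 mulr_suml; apply: ler_sum => i _.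
by rewrite expr2 ler_wpM2l // (bigD1 i) //= lerDl; apply: sumr_ge0.
Qed.

Fact hsum_normD x y : hsum_norm (x + y) <= hsum_norm x + hsum_norm y.
Proof.
pose r (z : hsum H) : 'rV[R[i]]_n := \row_i `|z i|.
have rE z : hsum_norm z = sqrtC (dotmx (r z) (r z)).
  rewrite dotmxE !mxE /hsum_norm; congr sqrtC; apply: eq_bigr => i _.
  by rewrite !mxE geC0_conj // expr2.
have [le_tri _] := triangle_lerif (@dotmx R[i] n) (r x) (r y).
rewrite [hsum_norm x]rE [hsum_norm y]rE; apply: le_trans le_tri.
have d0 := @dnorm_ge0 R[i] _ (@dotmx R[i] n).
rewrite ler_sqrtC ?nnegrE ?d0 ?hsum_sqr_ge0 //.
rewrite /= dotmxE !mxE; apply: ler_sum => i _.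
rewrite !mxE geC0_conj ?addr_ge0 // -expr2.
by rewrite lerXn2r ?nnegrE ?addr_ge0 // ler_normD.
Qed.
Fact hsum_normZ (a : R[i]) x : hsum_norm (a *: x) = `|a| * hsum_norm x.
Proof.
rewrite -[`|a|]sqrCK // -sqrtCM ?nnegrE ?exprn_ge0 ?hsum_sqr_ge0 //.
by rewrite mulr_sumr; congr sqrtC; apply: eq_bigr => i _; rewrite normrZ exprMn.
Qed.
Fact hsum_norm0 x : hsum_norm x = 0 -> x = 0.
Proof.
move=> /eqP; rewrite sqrtC_eq0 psumr_eq0 => [/allP x0|i _]; last exact: exprn_ge0.
apply: functional_extensionality_dep => i.
have := x0 i (mem_index_enum _).
by rewrite /= sqrf_eq0 normr_eq0 => /eqP.
Qed.

HB.instance Definition _ :=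
  Lmodule_isNormed.Build R[i] (hsum H) hsum_normD hsum_normZ hsum_norm0.

Fact hsum_complete (F : set_system (hsum H)) : ProperFilter F -> cauchy F -> cvg F.
Proof.
move=> FF /cauchy_ballP F_cauchy.
have coord_cvg i : cvg ((fun x : hsum H => x i) @ F).
  apply: cauchy_cvg; apply/cauchy_ballP => e e0 /=.
  have := F_cauchy e e0; rewrite !near_simpl => -[[/= P Q] [/= FP FQ] PQ].
  exists (P, Q) => // -[x y] /= xy.
  have := PQ (x, y) xy; rewrite -!ball_normE /=.
  by apply: le_lt_trans; exact: (hsum_coord_le (x - y) i).
pose l : hsum H := fun i => lim ((fun x : hsum H => x i) @ F).
apply/cvg_ex; exists l; apply/cvgrPdist_lt => e e0.
have near_coord i : \forall x \near F, `|l i - x i| < e / n.+1%:R.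
  by move/cvgrPdist_lt : (coord_cvg i); apply; rewrite divr_gt0.
apply: filterS (filter_forall _ near_coord) => x x_near.
apply: le_lt_trans (hsum_norm_le _) _.
apply: (@le_lt_trans _ _ (\sum_(i < n) e / n.+1%:R)).
  by apply: ler_sum => i _; apply: ltW; exact: x_near.
rewrite sumr_const card_ord -[ltLHS]mulr_natr mulrAC ltr_pdivrMr //.
by rewrite ltr_pM2l // ltr_nat.
Qed.

HB.instance Definition _ := Uniform_isComplete.Build (hsum H) hsum_complete.

Fact hsum_inner_bilinear :
  bilinear_for *%R (@Num.conj R[i] \; *%R) (hsum_inner : hsum H -> hsum H -> R[i]).
Proof.
by split=> z c x y /=; rewrite /hsum_inner mulr_sumr -big_split /=;
  apply: eq_bigr => i _; rewrite ?(linearPl, linearPr, linearP) //=;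
  rewrite linearDl linearZl_LR.
Qed.
HB.instance Definition _ := bilinear_isBilinear.Build R[i] (hsum H) (hsum H) R[i]
   *%R (@Num.conj R[i] \; *%R) hsum_inner hsum_inner_bilinear.

Fact hsum_inner_hermitian x y :
  hsum_inner x y = (-1) ^+ false * (hsum_inner y x)^*%R.
Proof.
rewrite expr0 mul1r /hsum_inner rmorph_sum /=; apply: eq_bigr => i _.
by rewrite (hermC (inner (s := H i))) expr0 mul1r.
Qed.
HB.instance Definition _ := isHermitianSesquilinear.Build R[i] (hsum H) false
   (@Num.conj R[i]) hsum_inner hsum_inner_hermitian.

Fact hsum_inner_gt0 x : x != 0 -> 0 < hsum_inner x x.
Proof.
move=> x0; rewrite -[_ x x](_ : hsum_norm x ^+ 2 = _).
  rewrite exprn_gt0 // lt_def sqrtC_ge0 hsum_sqr_ge0 andbT.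
  by apply: contra_neq x0 => /hsum_norm0.
by rewrite sqrtCK; apply: eq_bigr => i _; rewrite sqr_norm_inner.
Qed.
HB.instance Definition _ := isDotProduct.Build R[i] (hsum H) hsum_inner hsum_inner_gt0.

Fact hsum_sqr_norm x : `|x| ^+ 2 = hsum_inner x x.
Proof.
by rewrite sqrtCK; apply: eq_bigr => i _; rewrite sqr_norm_inner.
Qed.
HB.instance Definition _ := CompleteNormedModule_isHilbert.Build R (hsum H)
  hsum_sqr_norm.
End hsum_hilbert.

Section operator_matrix.
Context (R : realType) (n : nat) (H : 'I_n -> hilbertType R).

Definition opmx (A : forall i j, 'B(H j, H i)) (x : hsum H) : hsum H :=
  fun i => \sum_j A i j (x j).

Context (A : forall i j, 'B(H j, H i)).

Fact opmx_linear : linear (opmx A).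
Proof.
move=> a x y; apply: functional_extensionality_dep => i.
rewrite /opmx [RHS](_ : _ = a *: (\sum_j A i j (x j)) + \sum_j A i j (y j)) //.
rewrite scaler_sumr -big_split /=; apply: eq_bigr => j _.
exact: (linearP (A i j)).
Qed.

Fact opmx_bounded : exists M : R, forall x, `|opmx A x| <= M%:C * `|x|.
Proof.
pose P i j (M : R) := forall x : H j, `|A i j x| <= M%:C * `|x|.
have exM i j : exists M, P i j M := bounded_subproof.
pose M i j := xget 0 (P i j).
have M_bound i j (x : H j) : `|A i j x| <= (M i j)%:C * `|x|.
  by have [m Pm] := exM i j; exact: (xgetPex 0 (ex_intro _ m Pm)).
exists (\sum_i \sum_j `|M i j|) => x.
apply: le_trans (hsum_norm_le _) _.
rewrite rmorph_sum mulr_suml; apply: ler_sum => i _.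
rewrite rmorph_sum mulr_suml; apply: le_trans (ler_norm_sum _ _ _) _.
apply: ler_sum => j _; apply: le_trans (M_bound i j (x j)) _.
apply: (@le_trans _ _ (`|M i j|%:C * `|x j|)).
  by rewrite ler_wpM2r // lecR ler_norm.
by apply: ler_wpM2l; rewrite ?lecR //; exact: hsum_coord_le.
Qed.

HB.instance Definition _ :=
  GRing.isLinear.Build R[i] (hsum H) (hsum H) *:%R (opmx A) opmx_linear.
HB.instance Definition _ :=
  isBounded.Build R (hsum H) (hsum H) (opmx A) opmx_bounded.
End operator_matrix.

Section matrix_on_Cn.
Context (R : realType) (n : nat).

Definition Cn : hilbertType R := hsum (fun _ : 'I_n => R[i] : hilbertType R).

Definition mxop (M : 'M[R[i]]_n) (x : Cn) : Cn := fun i => \sum_j M i j * x j.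

Section scaling.
Context (a : R[i]).

Fact scale_bounded :
  exists M : R, forall x : R[i], `|a *: x| <= M%:C * `|x|.
Proof. by exists (complex.Re `|a|) => x; rewrite normrZ RRe_real ?normr_real. Qed.

HB.instance Definition _ := isBounded.Build R R[i] R[i] ( *:%R a) scale_bounded.
End scaling.

HB.instance Definition _ (M : 'M[R[i]]_n) :=
  BoundedOp.copy (mxop M) (opmx (fun i j => *:%R (M i j) : 'B(R[i], R[i]))).
End matrix_on_Cn.

(* Main.v *)
Require Import Defs.
From HB Require Import structures.
From mathcomp Require Import all_boot all_order all_algebra.
From mathcomp Require Import complex ring.
From mathcomp Require Import all_classical all_reals all_analysis.

(** The inequality comes from testing the scalar matrix against the vector of
norms. For a unit vector x of the direct sum, <Ax, x> is the sum over i, j of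
<A_ij x_j, x_i>. The diagonal terms are at most w(A_ii) |x_i|^2. The two terms
of an off-diagonal pair are estimated together: with B = A_ij, C = A_ji,
p = |B| and q = |C|,

  |<By, x> + <Cx, y>|^2 <= |<By, x>|^2 + |<Cx, y>|^2 + 2 |<By, x>| |<Cx, y>|,

where the squares are at most p^2 |x|^2 |y|^2 and q^2 |x|^2 |y|^2, and the
cross term is at most (p q + w(CB)) |x|^2 |y|^2. The sum of these bounds is
a_ij^2 |x|^2 |y|^2, since p^2 + q^2 + p q + w(CB) is another form of
(p + q)^2 - (p q - w(CB)); this is [pair_bound_ge]. Hence |<Ax, x>| is at most
the sum of the a_ij |x_j| |x_i|, which is the quadratic form of the matrix (a_ij)
at the unit vector t = (|x_1|, ..., |x_n|) of C^n, hence at most the numerical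
radius of that matrix.

The bound on the cross term, [Buzano_comp], is Buzano's inequality

  2 |<u, x> <x, v>| <= |x|^2 (|u| |v| + |<u, v>|)

for u = By and v = C^* y. Buzano's inequality holds because
2 <u, x> x - |x|^2 u is |x|^2 times the reflection of u in the line of x and so
has norm |x|^2 |u| ([reflection_norm]). Applying C to this vector before pairing
it with y, instead of pairing it with C^* y, avoids the adjoint. *)

Set Implicit Arguments.
Unset Strict Implicit.
Unset Printing Implicit Defensive.

Import Order.TTheory GRing.Theory Num.Theory.
Import numFieldNormedType.Exports.

Local Open Scope complex_scope.
Local Open Scope ring_scope.

(** * Inner products and the bounds given by the two suprema *)

Section numerical_radius.
Context {R : realType}.

Lemma ReK_ge0 (z : R[i]) : 0 <= z -> (complex.Re z)%:C = z.
Proof. by move=> z0; rewrite RRe_real // ger0_real. Qed.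

Section inner_product.
Context {H : hilbertType R}.
Implicit Types u v x : H.

Lemma inner_conj u v : inner u v = (inner v u)^*%R.
Proof. by rewrite (hermC (inner (s := H))) expr0 mul1r. Qed.

Lemma innerZl (c : R[i]) u v : inner (c *: u) v = c * inner u v.
Proof. by rewrite linearZl_LR. Qed.

Lemma innerZr (c : R[i]) u v : inner u (c *: v) = c^*%R * inner u v.
Proof. by rewrite linearZ. Qed.

Lemma innerBl u v x : inner (u - v) x = inner u x - inner v x.
Proof. by rewrite linearBl. Qed.

Lemma sqr_normB u v :
  `|u - v| ^+ 2 = `|u| ^+ 2 + `|v| ^+ 2 - (inner u v + (inner u v)^*%R).
Proof. by rewrite !sqr_norm_inner dnormB. Qed.

(** The nonnegative squared norm of |v|^2 u - <u, v> v, which is |v|^2 times the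
component of u orthogonal to v, is |v|^2 times the gap in the inequality. *)
Lemma inner_CauchySchwarz u v : `|inner u v| <= `|u| * `|v|.
Proof.
have [->|v0] := eqVneq v 0; first by rewrite linear0 !normr0 mulr0.
have v_gt0 : 0 < `|v| ^+ 2 by rewrite exprn_gt0 // normr_gt0.
have sqrE : `|(`|v| ^+ 2 *: u) - inner u v *: v| ^+ 2 =
    `|v| ^+ 2 * ((`|u| * `|v|) ^+ 2 - `|inner u v| ^+ 2).
  rewrite sqr_normB !innerZl !innerZr !normrZ !normr_id.
  rewrite (mulrC _^*%R) -normCK (@geC0_conj _ (_ * _)) ?mulr_ge0 ?exprn_ge0 //.
  ring.
have : 0 <= `|(`|v| ^+ 2 *: u) - inner u v *: v| ^+ 2 by exact: exprn_ge0.
by rewrite sqrE pmulr_rge0 // subr_ge0 ler_pXn2r ?nnegrE ?mulr_ge0.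
Qed.

(** When |x| = 1, the vector on the left is the image of u by the reflection that
fixes x and negates its orthogonal complement, which is an isometry. The factors
|x|^2 make the identity homogeneous, so that no vector has to be normalised. *)
Lemma reflection_norm u x :
  `|(inner u x *+ 2) *: x - (`|x| ^+ 2) *: u| = `|x| ^+ 2 * `|u|.
Proof.
apply/eqP; rewrite -(@eqrXn2 _ 2) ?mulr_ge0 ?exprn_ge0 //; apply/eqP.
rewrite sqr_normB !innerZl !innerZr !normrZ !normr_id.
rewrite (inner_conj x u) (@geC0_conj _ (`|x| ^+ 2)) ?exprn_ge0 //.
have -> : inner u x *+ 2 * (`|x| ^+ 2 * (inner u x)^*%R) =
    (`|inner u x| * `|x|) ^+ 2 *+ 2 by rewrite exprMn normCK; ring.
rewrite geC0_conj ?mulrn_wge0 ?exprn_ge0 ?mulr_ge0 //.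
rewrite normrMn; ring.
Qed.
End inner_product.

Lemma numradius_ge (H : hilbertType R) (A : 'B(H, H)) (x : H) :
  `|inner (A x) x| <= (numradius A)%:C * `|x| ^+ 2.
Proof.
have [->|x0] := eqVneq x 0; first by rewrite linear0 !normr0 expr0n mulr0.
have nx0 : 0 < `|x| by rewrite normr_gt0.
pose u := `|x|^-1 *: x.
have u1 : `|u| = 1 by rewrite normrZ normfV normr_id mulVf ?gt_eqF.
have -> : `|inner (A x) x| = `|inner (A u) u| * `|x| ^+ 2.
  have -> : A x = `|x| *: A u by rewrite -linearZ scalerA mulfV ?gt_eqF ?scale1r.
  have {2}-> : x = `|x| *: u by rewrite scalerA mulfV ?gt_eqF ?scale1r.
  rewrite innerZl innerZr geC0_conj ?normr_ge0 // mulrA -expr2 normrM normrX.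
  by rewrite normr_id mulrC.
rewrite ler_pM2r ?exprn_gt0 // -[leLHS]ReK_ge0 // lecR.
apply: ub_le_sup; last by exists u.
have [M AM] := @bounded_subproof R H H A.
exists M => _ [y y1 <-]; rewrite -lecR ReK_ge0 //.
apply: le_trans (inner_CauchySchwarz _ _) _.
by rewrite y1 mulr1; apply: le_trans (AM y) _; rewrite y1 mulr1.
Qed.

(** The hypothesis [0 <= M] matters on the trivial space, where no unit vector
exists and the numerical radius is the supremum 0 of the empty set. *)
Lemma numradius_le (H : hilbertType R) (A : 'B(H, H)) (M : R) :
  0 <= M -> (forall x : H, `|x| = 1 -> `|inner (A x) x| <= M%:C) ->
  numradius A <= M.
Proof.
move=> M0 AM; rewrite /numradius; set S := (X in sup X).
have [->|/set0P S0] := eqVneq S set0; first by rewrite sup0.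
by apply: ge_sup => // _ [x x1 <-]; rewrite -lecR ReK_ge0 //; exact: AM.
Qed.

Lemma numradius_ge0 (H : hilbertType R) (A : 'B(H, H)) : 0 <= numradius A.
Proof.
rewrite /numradius; set S := (X in sup X).
have [->|/set0P [r [x x1 rE]]] := eqVneq S set0; first by rewrite sup0.
rewrite -lecR; apply: le_trans (normr_ge0 (inner (A x) x)) _.
by have := numradius_ge A x; rewrite x1 expr1n mulr1.
Qed.

Lemma opnorm_unit_ball (H K : hilbertType R) (A : 'B(H, K)) (x : H) :
  `|x| <= 1 -> `|A x| <= (opnorm A)%:C.
Proof.
move=> x1; rewrite -[leLHS]ReK_ge0 // lecR.
apply: ub_le_sup; last by exists x.
have [M AM] := @bounded_subproof R H K A.
exists `|M| => _ [y /= y1 <-]; rewrite -lecR ReK_ge0 //.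
apply: le_trans (AM y) _.
apply: (@le_trans _ _ (`|M|%:C * `|y|)).
  by rewrite ler_wpM2r // lecR ler_norm.
by rewrite ler_piMr // lecR.
Qed.

Lemma opnorm_ge0 (H K : hilbertType R) (A : 'B(H, K)) : 0 <= opnorm A.
Proof.
rewrite -lecR; apply: le_trans (normr_ge0 (A 0)) _.
by apply: opnorm_unit_ball; rewrite normr0.
Qed.

Lemma opnorm_ge (H K : hilbertType R) (A : 'B(H, K)) (x : H) :
  `|A x| <= (opnorm A)%:C * `|x|.
Proof.
have [->|x0] := eqVneq x 0; first by rewrite linear0 !normr0 mulr0.
have nx0 : 0 < `|x| by rewrite normr_gt0.
pose u := `|x|^-1 *: x.
have u1 : `|u| = 1 by rewrite normrZ normfV normr_id mulVf ?gt_eqF.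
have -> : A x = `|x| *: A u by rewrite -linearZ scalerA mulfV ?gt_eqF ?scale1r.
by rewrite normrZ normr_id mulrC ler_pM2r // opnorm_unit_ball // u1.
Qed.

Lemma inner_op_le (H K : hilbertType R) (A : 'B(H, K)) (x : H) (y : K) :
  `|inner (A x) y| <= (opnorm A)%:C * (`|x| * `|y|).
Proof.
apply: le_trans (inner_CauchySchwarz _ _) _.
by rewrite mulrA ler_wpM2r // opnorm_ge.
Qed.

(** * Pairs of off-diagonal entries *)

(** The identity behind the estimate is
2 <By, x> <Cx, y> = <Cv, y> + |x|^2 <CBy, y>, where v = 2 <By, x> x - |x|^2 By
has norm |x|^2 |By|. *)
Lemma Buzano_comp (H K : hilbertType R) (B : 'B(H, K)) (C : 'B(K, H))
    (x : K) (y : H) :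
  `|inner (B y) x| * `|inner (C x) y| *+ 2 <=
  (opnorm B * opnorm C + numradius (C \o B))%:C * (`|x| * `|y|) ^+ 2.
Proof.
pose v := (inner (B y) x *+ 2) *: x - (`|x| ^+ 2) *: B y.
have -> : `|inner (B y) x| * `|inner (C x) y| *+ 2 =
    `|inner (C v) y + `|x| ^+ 2 * inner (C (B y)) y|.
  rewrite /v linearB 2!linearZ /= innerBl !innerZl subrK normrM.
  by rewrite normrMn mulrnAl.
apply: le_trans (ler_normD _ _) _.
rewrite rmorphD mulrDl; apply: lerD.
  apply: le_trans (inner_op_le _ _ _) _; rewrite reflection_norm.
  rewrite [leRHS](_ : _ =
      (opnorm C)%:C * (`|x| ^+ 2 * ((opnorm B)%:C * `|y|) * `|y|));
    last by rewrite rmorphM; ring.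
  rewrite ler_wpM2l ?lecR ?opnorm_ge0 // ler_wpM2r //.
  by rewrite ler_wpM2l ?exprn_ge0 ?opnorm_ge.
rewrite normrM normrX normr_id exprMn mulrCA ler_wpM2l ?exprn_ge0 //.
exact: (numradius_ge (C \o B)).
Qed.

Definition pair_bound (H K : hilbertType R) (B : 'B(H, K)) (C : 'B(K, H)) : R :=
  Num.sqrt ((opnorm B + opnorm C) ^+ 2
            - (opnorm B * opnorm C - numradius (C \o B))).

Lemma pair_bound_ge (H K : hilbertType R) (B : 'B(H, K)) (C : 'B(K, H))
    (x : K) (y : H) :
  `|inner (B y) x + inner (C x) y| <= (pair_bound B C)%:C * (`|x| * `|y|).
Proof.
have [p0 q0] := (opnorm_ge0 B, opnorm_ge0 C).
have w0 := numradius_ge0 (C \o B).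
have Bz := Buzano_comp B C x y.
rewrite /pair_bound; set p := opnorm B in p0 Bz *; set q := opnorm C in q0 Bz *.
set w := numradius _ in w0 Bz *.
have -> : (p + q) ^+ 2 - (p * q - w) = p ^+ 2 + q ^+ 2 + (p * q + w) by ring.
have s0 : 0 <= p ^+ 2 + q ^+ 2 + (p * q + w).
  by rewrite !addr_ge0 ?exprn_ge0 ?mulr_ge0.
have sC0 : 0 <= (Num.sqrt (p ^+ 2 + q ^+ 2 + (p * q + w)))%:C.
  by rewrite lecR sqrtr_ge0.
have pC0 : 0 <= p%:C by rewrite lecR.
have qC0 : 0 <= q%:C by rewrite lecR.
rewrite -(@ler_pXn2r _ 2) ?nnegrE ?mulr_ge0 // [leRHS]exprMn.
have sqrtK (r : R) : 0 <= r -> (Num.sqrt r)%:C ^+ 2 = r%:C.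
  by move=> r0; rewrite -[_ ^+ 2]rmorphXn /= sqr_sqrtr.
rewrite sqrtK // rmorphD mulrDl.
apply: (@le_trans _ _ ((`|inner (B y) x| + `|inner (C x) y|) ^+ 2)).
  by rewrite lerXn2r ?nnegrE ?addr_ge0 // ler_normD.
rewrite sqrrD addrAC; apply: lerD; last exact: Bz.
rewrite rmorphD mulrDl !rmorphXn -!exprMn; apply: lerD.
  by rewrite lerXn2r ?nnegrE ?mulr_ge0 // (mulrC `|x|) inner_op_le.
by rewrite lerXn2r ?nnegrE ?mulr_ge0 // inner_op_le.
Qed.

(** Sums a square array by gathering each entry below the diagonal with its mirror
image above it, to match the upper triangular shape of the scalar matrix. *)
Lemma sum_pairs (V : nmodType) (n : nat) (f : 'I_n -> 'I_n -> V) :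
  \sum_i \sum_j f i j =
  \sum_i \sum_j (if i == j then f i i
                 else if (i < j)%N then f i j + f j i else 0).
Proof.
pose g (i j : 'I_n) : V := if (i < j)%N then f j i else 0.
have -> : \sum_i \sum_j f i j =
    \sum_(i < n) \sum_(j < n) (if (j < i)%N then 0 else f i j)
    + \sum_i \sum_j g i j.
  rewrite [X in _ + X]exchange_big /= -big_split /=; apply: eq_bigr => i _.
  rewrite -big_split /=; apply: eq_bigr => j _.
  by rewrite /g; case: ifP; rewrite ?add0r ?addr0.
rewrite -big_split /=; apply: eq_bigr => i _.
rewrite -big_split /=; apply: eq_bigr => j _.
rewrite /g -(inj_eq val_inj) /=.
by have [ij|ij|/val_inj ->] := ltngtP i j; rewrite ?addr0.
Qed.

End numerical_radius.

(** * Comparison with the scalar matrix *)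

Theorem theorem1p2 (R : realType) (n : nat) (n_gt0 : (0 < n)%N)
    (H : 'I_n -> hilbertType R) (A : forall i j : 'I_n, 'B(H j, H i)) :
  let a : 'M[R]_n := \matrix_(i, j)
    if i == j then numradius (A i i)
    else if (i < j)%N then
      Num.sqrt ((opnorm (A i j) + opnorm (A j i)) ^+ 2
                - (opnorm (A i j) * opnorm (A j i)
                   - numradius (A j i \o A i j)))
    else 0 in
  numradius (opmx A) <= numradius (mxop (map_mx (real_complex R) a)).
Proof.
(* The [let] stands below the coercion of the boolean inequality to [Prop], so
   it cannot be introduced. *)
lazy zeta; set a := (X in mxop (map_mx _ X)).
apply: numradius_le => [|x x1]; first exact: numradius_ge0.
pose t : Cn R n := fun i => `|x i|.
have t1 : `|t| = 1.
  by rewrite -x1; congr sqrtC; apply: eq_bigr => i _; rewrite normr_id.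
have := numradius_ge (mxop (map_mx (real_complex R) a)) t.
rewrite t1 expr1n mulr1; apply: le_trans.
have -> : inner (mxop (map_mx (real_complex R) a) t) t =
    \sum_i \sum_j (a i j)%:C * (`|x j| * `|x i|).
  apply: eq_bigr => i _; rewrite [LHS]mulr_suml; apply: eq_bigr => j _.
  by rewrite mxE -mulrA; congr (_ * (_ * _)); exact: (geC0_conj (normr_ge0 _)).
have -> : inner (opmx A x) x = \sum_i \sum_j inner (A i j (x j)) (x i).
  by apply: eq_bigr => i _; exact: linear_sumlz.
set S := \sum_i \sum_j (a i j)%:C * _.
(* A sum that bounds a norm is nonnegative, hence equal to its own norm. *)
suff le_S : `|\sum_i \sum_j inner (A i j (x j)) (x i)| <= S.
  by rewrite [leRHS]ger0_norm // (le_trans _ le_S).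
rewrite sum_pairs; apply: le_trans (ler_norm_sum _ _ _) _.
apply: ler_sum => i _; apply: le_trans (ler_norm_sum _ _ _) _.
apply: ler_sum => j _; rewrite mxE.
have [<-|ij] := eqVneq i j; first by rewrite -expr2 numradius_ge.
case: ifP => _; last by rewrite normr0 mul0r.
by rewrite (mulrC `|x j|) pair_bound_ge.
Qed.
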